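(* Let $T>0$, $d\ge1$, $1\le p<\infty$ and $x_0\in R^d$. Let $F\in BV_p(Conv(R^d))$ be a Hukuhara differentiable set-valued function on $[0,T]$ with $F(0)=\{x_0\}$. Then there exists a Castaing representation $\{f_n\}_{n=1}^\infty$ of $F$ with $f_n\in\mathcal{IS}(F)$ for every $n=1,2,\dots$.
   Context: $R^d$ carries the Euclidean norm $\|\cdot\|$. $Conv(R^d)$ is the family of nonempty compact convex subsets of $R^d$, with the Hausdorff metric $H_{R^d}$. For a function $f$ from $[0,T]$ into a metric space $(E,\rho)$, the Riesz $p$-variation is $V_p(f)=\sup\sum_{i=1}^n\frac{\rho(f(t_{i-1}),f(t_i))^p}{(t_i-t_{i-1})^{p-1}}$, the supremum being over all partitions $0=t_0<\dots<t_n=T$. $BV_p(R^d)$ and $BV_p(Conv(R^d))$ are the classes of functions $[0,T]\to R^d$, respectively $[0,T]\to(Conv(R^d),H_{R^d})$, with finite $V_p$. For $A,B\in Conv(R^d)$, the Hukuhara difference $A\div B$ is the set $C\in Conv(R^d)$ with $A=B+C$ (Minkowski sum), if it exists. $G:[0,T]\to Conv(R^d)$ is Hukuhara differentiable at $t_0$ if there is $D_HG(t_0)=D_H(G)(t_0)\in Conv(R^d)$ such that the limits $\lim_{\Delta t\to0+}\frac{G(t_0+\Delta t)\div G(t_0)}{\Delta t}$ and $\lim_{\Delta t\to0+}\frac{G(t_0)\div G(t_0-\Delta t)}{\Delta t}$ exist and both equal $D_HG(t_0)$; it is Hukuhara differentiable if this holds at every point of $[0,T]$ (only the one-sided limit that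 makes sense being required at the endpoints). $S_{V_p}(F)=\{f\in BV_p(R^d): f(t)\in F(t),\ t\in[0,T]\}$; $S_{L^p}(\Phi)=\{\phi\in L^p([0,T],R^d):\phi(t)\in\Phi(t)\text{ for a.e. }t\}$; and $\mathcal{IS}(F)=\{f\in BV_p(R^d): f\in S_{V_p}(F)\text{ and } f'\in S_{L^p}(D_H(F))\}$, where $f'$ is the a.e. derivative of $f$. A sequence $\{f_n\}_{n=1}^\infty$ of selections of $F$ is a Castaing representation of $F$ if $F(t)=\overline{\{f_n(t):n\ge1\}}$ for every $t\in[0,T]$. *)

(* Defs.v *)
From mathcomp Require Import all_boot all_order all_algebra.
From mathcomp Require Import all_classical all_reals all_analysis.

Set Implicit Arguments.
Unset Strict Implicit.
Unset Printing Implicit Defensive.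

Import Order.TTheory GRing.Theory Num.Theory.
Import numFieldNormedType.Exports.

Local Open Scope classical_set_scope.
Local Open Scope ring_scope.

(* Functions on [0, T] are total functions on R; every definition below only
   depends on their values on [0, T]. *)

Section Definitions.
Context {R : realType}.

(* The norm of the library on 'rV[R]_d is the sup norm: it induces the same
   topology as the Euclidean norm, hence the same compact sets, closures and
   derivatives, but not the same Hausdorff metric or p-variation. *)
Definition euclidean_norm {d : nat} (x : 'rV[R]_d) : R :=
  Num.sqrt (\sum_i x 0 i ^+ 2).

Definition euclidean_dist {d : nat} (x y : 'rV[R]_d) : R :=
  euclidean_norm (x - y).

Definition Conv {d : nat} : set (set 'rV[R]_d) :=
  [set A | [/\ A !=set0, compact A &
               convex_set (A : set (convex_lmodType 'rV[R]_d))]].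

Definition dist_to_set {d : nat} (x : 'rV[R]_d) (A : set 'rV[R]_d) : R :=
  inf [set euclidean_dist x a | a in A].

(* The real-valued [sup] and [inf] are junk on unbounded or empty sets; this is
   only used on nonempty compact sets. *)
Definition hausdorff_dist {d : nat} (A B : set 'rV[R]_d) : R :=
  Num.max (sup [set dist_to_set a B | a in A])
          (sup [set dist_to_set b A | b in B]).

Section Riesz_variation.
Context {E : Type} (rho : E -> E -> R) (p a b : R) (f : R -> E).

(* The partition a = t_0 < ... < t_n = b is coded, as in [itv_partition], by
   s = [:: t_1; ...; t_n]. *)
Definition riesz_sum (s : seq R) : R :=
  let t := nth b (a :: s) in
  \sum_(0 <= i < size s)
    rho (f (t i)) (f (t i.+1)) `^ p / (t i.+1 - t i) `^ (p - 1).

Definition riesz_variation : \bar R :=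
  ereal_sup [set (riesz_sum s)%:E | s in itv_partition a b].

End Riesz_variation.

Definition BVp {d : nat} (T p : R) : set (R -> 'rV[R]_d) :=
  [set f | (riesz_variation euclidean_dist p 0 T f < +oo)%E].

Definition BVpConv {d : nat} (T p : R) : set (R -> set 'rV[R]_d) :=
  [set F | (forall t : R, 0 <= t <= T -> Conv (F t)) /\
           (riesz_variation hausdorff_dist p 0 T F < +oo)%E].

Definition minkowski_sum {d : nat} (A B : set 'rV[R]_d) : set 'rV[R]_d :=
  [set a + b | a in A & b in B].

(* C is the Hukuhara difference of A and B, a partial operation. *)
Definition is_hukuhara_diff {d : nat} (A B C : set 'rV[R]_d) : Prop :=
  Conv C /\ A = minkowski_sum B C.

(* The Hukuhara difference of A h and B h exists for small h > 0 and, divided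
   by h, it tends to D in the Hausdorff metric as h tends to 0+. *)
Definition hukuhara_quotient_cvg {d : nat} (A B : R -> set 'rV[R]_d)
    (D : set 'rV[R]_d) : Prop :=
  forall e : R, 0 < e -> \forall h \near (0 : R)^'+,
    exists2 C, is_hukuhara_diff (A h) (B h) C &
               hausdorff_dist [set h^-1 *: c | c in C] D < e.

Definition is_hukuhara_derivative {d : nat} (T : R) (G : R -> set 'rV[R]_d)
    (t : R) (D : set 'rV[R]_d) : Prop :=
  [/\ Conv D,
      t < T -> hukuhara_quotient_cvg (fun h => G (t + h)) (fun=> G t) D &
      0 < t -> hukuhara_quotient_cvg (fun=> G t) (fun h => G (t - h)) D].

Definition hukuhara_differentiable {d : nat} (T : R)
    (G : R -> set 'rV[R]_d) : Prop :=
  forall t : R, 0 <= t <= T -> exists D, is_hukuhara_derivative T G t D.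

(* Hukuhara derivatives are unique, so that [get] picks the derivative wherever
   there is one. *)
Definition hukuhara_derivative {d : nat} (T : R) (G : R -> set 'rV[R]_d)
    (t : R) : set 'rV[R]_d :=
  get [set D | is_hukuhara_derivative T G t D].

Definition S_Vp {d : nat} (T p : R) (F : R -> set 'rV[R]_d) :
    set (R -> 'rV[R]_d) :=
  [set f | BVp T p f /\ forall t : R, 0 <= t <= T -> F t (f t)].

Definition Lp {d : nat} (T p : R) : set (R -> 'rV[R]_d) :=
  [set phi : R -> 'rV[R]_d | (forall i, measurable_fun `[0, T] (fun t => phi t 0 i)) /\
    (\int[lebesgue_measure]_(t in `[0%R, T])
       (euclidean_norm (phi t) `^ p)%:E < +oo)%E].

Definition S_Lp {d : nat} (T p : R) (Phi : R -> set 'rV[R]_d) :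
    set (R -> 'rV[R]_d) :=
  [set phi : R -> 'rV[R]_d | Lp T p phi /\
    {ae lebesgue_measure, forall t : R, 0 <= t <= T -> Phi t (phi t)}].

(* f' is only defined almost everywhere: phi is a representative of it. *)
Definition is_ae_derivative {d : nat} (T : R) (f phi : R -> 'rV[R]_d) : Prop :=
  {ae lebesgue_measure, forall t : R, 0 < t < T -> is_derive t 1 f (phi t)}.

Definition IS {d : nat} (T p : R) (F : R -> set 'rV[R]_d) :
    set (R -> 'rV[R]_d) :=
  [set f | S_Vp T p F f /\
    exists2 phi, is_ae_derivative T f phi &
                 S_Lp T p (hukuhara_derivative T F) phi].

Definition castaing_representation {d : nat} (T : R) (F : R -> set 'rV[R]_d)
    (f : nat -> R -> 'rV[R]_d) : Prop :=
  (forall n (t : R), 0 <= t <= T -> F t (f n t)) /\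
  (forall t : R, 0 <= t <= T -> F t = closure (range (fun n => f n t))).

End Definitions.

(* Main.v *)
(* A linear selector is a map [s] from convex bodies to points with [s A] in [A]
   which is additive, positively homogeneous and Lipschitz for the Hausdorff
   metric.  For such an [s], the selection [t |-> s (F t)] is differentiable at
   every point, with derivative [s (D_H F t)]; the Lipschitz bound controls its
   Riesz variation, and Fatou's lemma applied to the difference quotients along
   uniform partitions puts the derivative in [L^p].

   Selectors are obtained as averages of the gradient of the support function
   over large boxes: coordinate [i] of [sel A] is the limit, along an ultrafilter,
   of the averages of [y |-> suppf A (y + e_i) - suppf A y] over the integer
   points of a box of side [n] based at [n a].  These averages are asymptotically
   invariant under integer translations, so that [dot w (sel A)] is the limit of
   the averages of [suppf A (y + w) - suppf A y <= suppf A w] for integer [w],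
   which gives [sel A \in A]; and they telescope in direction [e_i], which gives
   the Lipschitz bound.  When [a] is a large multiple of an integer vector [z],
   the point [sel A] nearly maximizes [dot z] on [A], so that the iterated
   midpoints of the selectors, a countable family, are dense in [A]. *)

Require Import Defs.
From HB Require Import structures.
From mathcomp Require Import all_boot all_order all_algebra.
From mathcomp Require Import all_classical all_reals all_analysis.
From mathcomp Require Import measurable_realfun lra ring.
Import Order.TTheory GRing.Theory Num.Theory.
Import numFieldNormedType.Exports.
Local Open Scope classical_set_scope.
Local Open Scope ring_scope.

Set Implicit Arguments.
Unset Strict Implicit.
Unset Printing Implicit Defensive.

(** * Support functions *)

Section Support_functions.
Context {R : realType} {d : nat}.
Notation V := 'rV[R]_d.
Implicit Types (x y z : V) (A B C : set V).

Definition dot x y : R := \sum_i x 0 i * y 0 i.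

Lemma dotC x y : dot x y = dot y x.
Proof. by apply: eq_bigr => i _; rewrite mulrC. Qed.

Lemma dotDl x y z : dot (x + y) z = dot x z + dot y z.
Proof. by rewrite -big_split; apply: eq_bigr => i _; rewrite mxE mulrDl. Qed.

Lemma dotZl (c : R) x y : dot (c *: x) y = c * dot x y.
Proof. by rewrite mulr_sumr; apply: eq_bigr => i _; rewrite mxE mulrA. Qed.

Lemma dotNl x y : dot (- x) y = - dot x y.
Proof. by rewrite -scaleN1r dotZl mulN1r. Qed.

Lemma dotBl x y z : dot (x - y) z = dot x z - dot y z.
Proof. by rewrite dotDl dotNl. Qed.

Lemma dotDr x y z : dot z (x + y) = dot z x + dot z y.
Proof. by rewrite dotC dotDl !(dotC z). Qed.

Lemma dotZr (c : R) x y : dot x (c *: y) = c * dot x y.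
Proof. by rewrite dotC dotZl dotC. Qed.

Lemma dotBr x y z : dot z (x - y) = dot z x - dot z y.
Proof. by rewrite dotC dotBl !(dotC z). Qed.

Lemma dot_ge0 x : 0 <= dot x x.
Proof. by apply: sumr_ge0 => i _; exact: sqr_ge0. Qed.

Lemma dot_eq0 x : dot x x = 0 -> x = 0.
Proof.
move=> /eqP; rewrite psumr_eq0; last by move=> i _; exact: sqr_ge0.
move=> /allP x0; apply/rowP => i; rewrite mxE; apply/eqP.
by have := x0 i (mem_index_enum _); rewrite /= -expr2 sqrf_eq0.
Qed.

Lemma coord_le_norm x i : `|x 0 i| <= `|x|.
Proof.
rewrite [leRHS]/Num.norm /= mx_normrE.
by apply: (le_trans _ (@le_bigmax _ _ _ 0 (fun j : 'I_1 * 'I_d => `|x j.1 j.2|) (0, i))).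
Qed.

Lemma norm_le_coord x (B : R) :
  0 <= B -> (forall i, `|x 0 i| <= B) -> `|x| <= B.
Proof.
move=> B0 xB; rewrite [leLHS]/Num.norm /= mx_normrE.
by apply: bigmax_le => // -[i j] _ /=; rewrite ord1.
Qed.

(** The norm is the sup norm, whence the factor [d] where Cauchy-Schwarz would have 1. *)
Lemma dot_bound x y : `|dot x y| <= d%:R * `|x| * `|y|.
Proof.
apply: (le_trans (ler_norm_sum _ _ _)).
apply: (@le_trans _ _ (\sum_(i < d) `|x| * `|y|)).
  by apply: ler_sum => i _; rewrite normrM ler_pM// coord_le_norm.
by rewrite sumr_const card_ord -mulrA mulr_natl.
Qed.

Lemma coord_le_euclidean x i : `|x 0 i| <= euclidean_norm x.
Proof.
rewrite -sqrtr_sqr ler_sqrt; last by apply: sumr_ge0 => j _; exact: sqr_ge0.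
by rewrite (bigD1 i)//= lerDl; apply: sumr_ge0 => j _; exact: sqr_ge0.
Qed.

Lemma norm_le_euclidean x : `|x| <= euclidean_norm x.
Proof. by apply: norm_le_coord; [exact: sqrtr_ge0|exact: coord_le_euclidean]. Qed.

Lemma euclidean_le_norm x : euclidean_norm x <= d%:R * `|x|.
Proof.
have dx0 : 0 <= d%:R * `|x| by rewrite mulr_ge0.
rewrite -(ger0_norm dx0) -sqrtr_sqr ler_sqrt ?sqr_ge0//.
apply: (@le_trans _ _ (\sum_(i < d) `|x| ^+ 2)).
  apply: ler_sum => i _; rewrite -real_normK ?num_real//.
  by rewrite lerXn2r ?nnegrE// coord_le_norm.
(* The sum is [d] times the squared norm, and [d <= d ^ 2] gives the crude constant [d]. *)
rewrite sumr_const card_ord exprMn -[leLHS]mulr_natl ler_wpM2r ?sqr_ge0//.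
by rewrite -natrX ler_nat; case: (d) => // n; rewrite leq_pmulr.
Qed.

(** Enough for the suprema below to be genuine, and stable under sums and dilations without going
    through compactness and convexity again. *)
Definition bounded_nonempty A :=
  A !=set0 /\ exists2 M, 0 <= M & forall a, A a -> `|a| <= M.

Lemma Conv_bounded_nonempty A : Conv A -> bounded_nonempty A.
Proof.
case=> A0 /compact_bounded[M [_ AM]] _; split=> //.
exists (`|M| + 1); first by rewrite addr_ge0.
by move=> a Aa; apply: AM => //; rewrite ltr_pwDr// ler_norm.
Qed.

Definition suppf A y : R := sup [set dot y a | a in A].

Lemma has_sup_support A y : bounded_nonempty A -> has_sup [set dot y a | a in A].
Proof.
move=> [[a Aa] [M M0 AM]]; split; first by exists (dot y a), a.
exists (d%:R * `|y| * M) => _ [b Ab <-]; apply: le_trans (ler_norm _) _.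
by apply: le_trans (dot_bound _ _) _; rewrite ler_wpM2l// ?AM// mulr_ge0.
Qed.

Lemma support_ge A y a : bounded_nonempty A -> A a -> dot y a <= suppf A y.
Proof.
by move=> /(has_sup_support y)[_ hA] Aa; apply: ub_le_sup => //; exists a.
Qed.

Lemma support_le A y c : bounded_nonempty A ->
  (forall a, A a -> dot y a <= c) -> suppf A y <= c.
Proof.
move=> /(has_sup_support y)[A0 _] Ac.
by apply: ge_sup => // _ [a Aa <-]; exact: Ac.
Qed.

Lemma support0 A : bounded_nonempty A -> suppf A 0 = 0.
Proof.
have dot0 a : dot 0 a = 0 by rewrite -(scale0r 0) dotZl mul0r.
move=> bA; have [[a Aa] _] := bA; apply/eqP; rewrite eq_le; apply/andP; split.
  by apply: support_le => // b _; rewrite dot0.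
by rewrite -(dot0 a); exact: support_ge.
Qed.

Lemma supportD A y z : bounded_nonempty A ->
  suppf A (y + z) <= suppf A y + suppf A z.
Proof.
move=> bA; apply: support_le => // a Aa.
by rewrite dotDl lerD// support_ge.
Qed.

Lemma supportZ A h y : bounded_nonempty A -> 0 <= h ->
  suppf A (h *: y) = h * suppf A y.
Proof.
move=> bA; rewrite le_eqVlt => /predU1P[<-|h0].
  by rewrite scale0r support0// mul0r.
apply/eqP; rewrite eq_le; apply/andP; split.
  by apply: support_le => // a Aa; rewrite dotZl ler_pM2l// support_ge.
rewrite mulrC -ler_pdivlMr//; apply: support_le => // a Aa.
by rewrite ler_pdivlMr// mulrC -dotZl support_ge.
Qed.

Lemma support_bound A : bounded_nonempty A ->
  exists2 c, 0 <= c & forall y, `|suppf A y| <= c * `|y|.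
Proof.
move=> bA; have [[a Aa] [M M0 AM]] := bA.
have dot_le y b : A b -> `|dot y b| <= d%:R * M * `|y|.
  move=> Ab; apply: le_trans (dot_bound _ _) _.
  by rewrite -!mulrA ler_wpM2l// mulrC ler_wpM2r// AM.
exists (d%:R * M); first by rewrite mulr_ge0.
move=> y; rewrite ler_norml; apply/andP; split.
  by apply: le_trans _ (support_ge _ bA Aa); have := dot_le y a Aa; rewrite ler_norml => /andP[].
apply: support_le => // b Ab; exact: le_trans (ler_norm _) (dot_le _ _ Ab).
Qed.

Lemma support_minkowski A B y : bounded_nonempty A -> bounded_nonempty B ->
  suppf (minkowski_sum A B) y = suppf A y + suppf B y.
Proof.
move=> bA bB; have bAB : bounded_nonempty (minkowski_sum A B).
  have [[a Aa] [M M0 AM]] := bA; have [[b Bb] [N N0 BN]] := bB.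
  split; first by exists (a + b), a => //; exists b.
  exists (M + N); first exact: addr_ge0.
  by move=> _ [u Au [v Bv <-]]; rewrite (le_trans (ler_normD _ _))// lerD ?AM ?BN.
apply/eqP; rewrite eq_le; apply/andP; split.
  apply: support_le => // _ [a Aa [b Bb <-]].
  by rewrite dotDr lerD// support_ge.
rewrite -lerBrDr; apply: support_le => // a Aa.
rewrite lerBrDl -lerBrDr; apply: support_le => // b Bb.
by rewrite lerBrDl -dotDr; apply: support_ge => //; exists a => //; exists b.
Qed.

Lemma bounded_nonempty_scale A h : bounded_nonempty A ->
  bounded_nonempty [set h *: a | a in A].
Proof.
move=> [[a Aa] [M M0 AM]]; split; first by exists (h *: a), a.
exists (`|h| * M); first exact: mulr_ge0.
by move=> _ [b Ab <-]; rewrite normrZ ler_wpM2l// AM.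
Qed.

Lemma support_scale A h y : bounded_nonempty A -> 0 <= h ->
  suppf [set h *: a | a in A] y = h * suppf A y.
Proof.
move=> bA h0; rewrite -supportZ// /suppf; congr sup.
apply/seteqP; split => [_ [_ [a Aa <-] <-]|_ [a Aa <-]].
  by exists a => //; rewrite dotZr dotZl.
by exists (h *: a); [exists a|rewrite dotZr dotZl].
Qed.

Lemma dist_to_set_le_hausdorff A B a : bounded_nonempty A -> bounded_nonempty B ->
  A a -> dist_to_set a B <= hausdorff_dist A B.
Proof.
move=> [[a0 Aa0] [M M0 AM]] [[b0 Bb0] _] Aa.
rewrite le_max; apply/orP; left; apply: ub_le_sup; last by exists a.
(* A bound uniform in [u], through one fixed point of [B]; it makes the [sup] in [hausdorff_dist] a
   true supremum. *)
exists (d%:R * (M + `|b0|)) => _ [u Au <-].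
apply: (@le_trans _ _ (euclidean_dist u b0)).
  apply: ge_inf; last by exists b0.
  by exists 0 => _ [v Bv <-]; exact: sqrtr_ge0.
apply: le_trans (euclidean_le_norm _) _; rewrite ler_wpM2l//.
by apply: le_trans (ler_normB _ _) _; rewrite lerD2r AM.
Qed.

Lemma hausdorffC A B : hausdorff_dist A B = hausdorff_dist B A.
Proof. by rewrite /hausdorff_dist maxC. Qed.

Lemma hausdorff_ge0 A B : bounded_nonempty A -> bounded_nonempty B ->
  0 <= hausdorff_dist A B.
Proof.
move=> bA bB; have [[a Aa] _] := bA.
apply: le_trans _ (dist_to_set_le_hausdorff bA bB Aa).
have [[b Bb] _] := bB; apply: lb_le_inf; first by exists (euclidean_dist a b), b.
by move=> _ [u _ <-]; exact: sqrtr_ge0.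
Qed.

Lemma support_le_hausdorff A B y : bounded_nonempty A -> bounded_nonempty B ->
  suppf A y <= suppf B y + d%:R * `|y| * hausdorff_dist A B.
Proof.
move=> bA bB; apply: support_le => // a Aa; apply/ler_addgt0Pr => e e0.
have dy0 : 0 <= d%:R * `|y| by rewrite mulr_ge0.
have dy1 : 0 < d%:R * `|y| + 1 by rewrite ltr_wpDl.
have [[b0 Bb0] _] := bB.
(* An almost nearest point of [B]; the [+ 1] keeps the denominator positive when [y = 0]. *)
have [|_ [b Bb <-]] := @inf_adherent _ [set euclidean_dist a b | b in B]
  (e / (d%:R * `|y| + 1)) (divr_gt0 e0 dy1).
  split; first by exists (euclidean_dist a b0), b0.
  by exists 0 => _ [v Bv <-]; exact: sqrtr_ge0.
move=> ab; have {}ab : `|a - b| <= hausdorff_dist A B + e / (d%:R * `|y| + 1).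
  apply: le_trans (norm_le_euclidean _) _; apply: le_trans (ltW ab) _.
  by rewrite lerD2r; exact: dist_to_set_le_hausdorff.
rewrite -[a](subrK b) dotDr addrC -addrA lerD//; first exact: support_ge.
apply: le_trans (ler_norm _) _; apply: le_trans (dot_bound _ _) _.
apply: (le_trans (ler_wpM2l dy0 ab)).
rewrite mulrDr lerD2l mulrCA ger_pMr// ler_pdivrMr// mul1r lerDl//.
Qed.

(** The bound is linear in [|y|]: on a box of side [n] at distance of order [n] it costs a factor
    [n], which telescoping averages recover. *)
Lemma support_lipschitz A B y : bounded_nonempty A -> bounded_nonempty B ->
  `|suppf A y - suppf B y| <= d%:R * hausdorff_dist A B * `|y|.
Proof.
move=> bA bB; rewrite mulrAC ler_distl.
have := support_le_hausdorff y bA bB; have := support_le_hausdorff y bB bA.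
by rewrite (hausdorffC B A); lra.
Qed.

(* Rounding [n y] to an integer vector costs an error independent of [n]. *)
Lemma le_support_integer A x : bounded_nonempty A ->
  (forall z : 'rV[int]_d, dot (map_mx intr z) x <= suppf A (map_mx intr z)) ->
  forall y, dot y x <= suppf A y.
Proof.
move=> bA xA y; have [c c0 Ac] := support_bound bA.
pose K := d%:R * `|x| + c.
have K0 : 0 <= K by rewrite addr_ge0// mulr_ge0.
(* A positive excess would make these multiples unbounded, by the Archimedean property. *)
suff H (n : nat) : n%:R * (dot y x - suppf A y) <= K.
  rewrite leNgt; apply/negP; rewrite -subr_gt0 => e0.
  have := archi_boundP (divr_ge0 K0 (ltW e0)); rewrite ltr_pdivrMr//.
  by rewrite ltNge H.
pose z : 'rV[int]_d := \row_i Num.floor (n%:R * y 0 i).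
pose w := map_mx intr z : V.
have yw : `|n%:R *: y - w| <= 1.
  apply: norm_le_coord => // i; rewrite !mxE ler_norml.
  have := Num.Theory.floor_itv (n%:R * y 0 i).
  rewrite intrD; lra.
have h1 := xA z; rewrite -/w in h1.
have h2 : dot (n%:R *: y - w) x <= d%:R * `|x|.
  apply: le_trans (ler_norm _) _; apply: le_trans (dot_bound _ _) _.
  by rewrite -mulrA ler_wpM2l// ler_piMl.
have h3 : suppf A (w - n%:R *: y) <= c.
  apply: le_trans (ler_norm _) _; apply: le_trans (Ac _) _.
  by rewrite distrC ler_piMr.
have h4 : suppf A w <= n%:R * suppf A y + suppf A (w - n%:R *: y).
  by rewrite -supportZ// -[X in suppf A X <= _](subrK (n%:R *: y) w) addrC supportD.
by move: h2; rewrite dotBl dotZl /K; lra.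
Qed.

(** The part of convexity that a countable family of iterated midpoints satisfies, and that survives
    closure. *)
Definition midpoint_closed A :=
  forall a b, A a -> A b -> A (2^-1 *: (a + b)).

Lemma Conv_midpoint_closed A : Conv A -> midpoint_closed A.
Proof.
case=> _ _ cA a b Aa Ab.
have h0 : (0 : R) <= 2^-1 by lra.
have h1 : (2^-1 : R) <= 1 by lra.
have := @cA a b (Itv01 h0 h1); rewrite !inE => /(_ Aa Ab).
congr (A _); rewrite /conv /= scalerDr; congr (_ + _ *: _).
by rewrite -[LHS]/(1 - 2^-1); lra.
Qed.

(* The nearest point [b] of [A] to [x] satisfies [dot (x - b) (a - b) <= 0] for
   [a] in [A]; the points [b + 2^-n (a - b)], obtained by iterated midpoints,
   suffice to see it. *)
Lemma mem_le_support A x : compact A -> A !=set0 -> midpoint_closed A ->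
  (forall y, dot y x <= suppf A y) -> A x.
Proof.
move=> cA A0 mA xA.
have bA : bounded_nonempty A.
  split=> //; have /compact_bounded[M [_ AM]] := cA.
  exists (`|M| + 1); first by rewrite addr_ge0.
  by move=> a Aa; apply: AM => //; rewrite ltr_pwDr// ler_norm.
have cdot : continuous (fun a : V => dot (x - a) (x - a)).
  move=> a; apply: (@cvg_big _ _ _ 0 xpredT add_continuous _ (nbhs a)) => i _.
  have cx : (x - y) 0 i @[y --> a] --> (x - a) 0 i.
    have cB : x - y @[y --> a] --> x - a.
      by apply: (@cvgB R V V (nbhs a)); [exact: cvg_cst|exact: cvg_id].
    apply: (@cvg_comp _ _ _ (fun y : V => x - y) (fun y : V => y 0 i) _ (nbhs (x - a)) _ cB).
    exact: coord_continuous.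
  exact: (cvgM cx cx).
have [|b Ab bmin] := compact_EVT_min A0 cA
  (_ : {within A, continuous (fun a : V => dot (x - a) (x - a))}).
  by apply: continuous_subspaceT.
rewrite inE in Ab.
have step a n : A a -> A (b + 2^-1 ^+ n *: (a - b)).
  move=> Aa; elim: n => [|n IH]; first by rewrite expr0 scale1r addrC subrK.
  have := mA _ _ Ab IH; congr (A _); rewrite addrA scalerDr -mulr2n.
  by rewrite -[b *+ 2]scaler_nat !scalerA mulVf ?pnatr_eq0// scale1r exprS.
have ortho a : A a -> dot (x - b) (a - b) <= 0.
  move=> Aa; set k := dot (x - b) (a - b); set q := dot (a - b) (a - b).
  have H n : 2 * k <= 2^-1 ^+ n * q.
    have t0 : (0 : R) < 2^-1 ^+ n by rewrite exprn_gt0// invr_gt0.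
    have := bmin _ (mem_set (step a n Aa)).
    rewrite (_ : x - (b + _) = (x - b) - 2^-1 ^+ n *: (a - b)) ?opprD ?addrA//.
    rewrite /k /q; set t := 2^-1 ^+ n in t0 *.
    move: (x - b) (a - b) => w v h.
    (* Minimality of [b] against [b + t (a - b)] reads [2 t k <= t ^ 2 q]; division by [t > 0] gives
       the claim. *)
    have {h} : t * (2 * dot w v) <= t * (t * dot v v).
      move: h; rewrite dotBl !dotBr !dotZl !dotZr (dotC v w); lra.
    by rewrite ler_pM2l.
  rewrite leNgt; apply/negP => k0.
  have q0 : 0 <= q by exact: dot_ge0.
  have [n] : exists n, 2^-1 ^+ n * q < 2 * k.
    exists (Num.bound (q / (2 * k))); set n := Num.bound _.
    have k20 : 0 < 2 * k by lra.
    have qn : q < n%:R * (2 * k) by rewrite -ltr_pdivrMr// archi_boundP// divr_ge0// ltW.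
    rewrite exprVn mulrC ltr_pdivrMr ?exprn_gt0//.
    apply: (lt_le_trans qn); rewrite mulrC ler_pM2l// -natrX ler_nat.
    exact/ltnW/ltn_expl.
  by rewrite ltNge H.
suff xb : x - b = 0 by rewrite -[x](subrK b) xb add0r.
apply/dot_eq0/eqP; rewrite eq_le dot_ge0 andbT dotBr subr_le0.
apply: le_trans (xA _) _; apply: support_le => // a Aa.
by rewrite -subr_le0 -dotBr ortho.
Qed.

End Support_functions.

(** * Averages and ultralimits *)

Section Averages.
Context {R : realType} {V : normedModType R} (N : nat) (N0 : (0 < N)%N).
Implicit Types (l : seq V) (g h : V -> R) (x y v : V).

(** The mean of [h] over the points [x + k_1 v_1 + ... + k_r v_r] with [0 <= k_i < N], where [l]
    lists the [v_i]. *)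
Fixpoint avg l h x : R :=
  if l is v :: l' then N%:R^-1 * \sum_(k < N) avg l' h (x + v *+ k) else h x.

Let NR0 : 0 < N%:R :> R. Proof. by rewrite ltr0n. Qed.

Lemma eq_avg l g h x : g =1 h -> avg l g x = avg l h x.
Proof. by move=> /funext ->. Qed.

Lemma avgD l g h x : avg l (fun y => g y + h y) x = avg l g x + avg l h x.
Proof.
elim: l x => [//|v l IH] x /=.
by rewrite -mulrDr -big_split; congr (_ * _); apply: eq_bigr => k _; rewrite IH.
Qed.

Lemma avgZ l (c : R) h x : avg l (fun y => c * h y) x = c * avg l h x.
Proof.
elim: l x => [//|v l IH] x /=.
rewrite mulrCA; congr (_ * _); rewrite mulr_sumr.
by apply: eq_bigr => k _; rewrite IH.
Qed.

Lemma avgB l g h x : avg l (fun y => g y - h y) x = avg l g x - avg l h x.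
Proof.
rewrite -mulN1r -avgZ -avgD; apply: eq_avg => y; by rewrite mulN1r.
Qed.

Lemma avg_shift l h v x : avg l (fun y => h (y + v)) x = avg l h (x + v).
Proof.
elim: l x => [//|u l IH] x /=; congr (_ * _); apply: eq_bigr => k _.
by rewrite IH addrAC.
Qed.

(** The case [k = N] is included for the far end of the telescoping sum. *)
Lemma box_cons l v k x y : `|v| <= 1 -> (k <= N)%N ->
  `|y - (x + v *+ k)| <= N%:R * (size l)%:R ->
  `|y - x| <= N%:R * (size (v :: l))%:R.
Proof.
move=> v1 kN H.
rewrite (_ : y - x = y - (x + v *+ k) + v *+ k); last by rewrite opprD addrA subrK.
apply: le_trans (ler_normD _ _) _.
rewrite /= -natr1 mulrDr lerD// mulr1 normrMn.
by rewrite -[leLHS]mulr_natl -[leRHS]mulr1 ler_pM// ler_nat.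
Qed.

(** The bound on [h] is only asked near the box, so that functions of linear growth can be
    averaged. *)
Lemma avg_le l h x c : all (fun v => `|v| <= 1) l ->
  (forall y, `|y - x| <= N%:R * (size l)%:R -> h y <= c) -> avg l h x <= c.
Proof.
elim: l x => [x _ hc|v l IH x /= /andP[v1 l1] hc].
  by apply: hc; rewrite subrr normr0 mulr0.
rewrite ler_pdivrMl// mulr_natl -[N in leRHS]card_ord -sumr_const.
apply: ler_sum => k _; apply: IH => // y yk; apply: hc.
exact: box_cons v1 (ltnW (ltn_ord k)) yk.
Qed.

Lemma avg_norm_le l h x c : all (fun v => `|v| <= 1) l ->
  (forall y, `|y - x| <= N%:R * (size l)%:R -> `|h y| <= c) ->
  `|avg l h x| <= c.
Proof.
move=> l1 hc; rewrite ler_norml lerNl -mulN1r -avgZ; apply/andP; split.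
  by apply: avg_le => // y /hc; rewrite ler_norml mulN1r lerNl => /andP[].
by apply: avg_le => // y /hc; rewrite ler_norml => /andP[].
Qed.

(* Averaging [h (y + v) - h y] over the arithmetic progression of step [v]
   telescopes, which gains a factor [N]. *)
Lemma avg_diff_le l h v x c : all (fun v => `|v| <= 1) l -> v \in l ->
  (forall y, `|y - x| <= N%:R * (size l)%:R -> `|h y| <= c) ->
  `|avg l (fun y => h (y + v) - h y) x| <= 2 * c / N%:R.
Proof.
have normNV : `|N%:R^-1 : R| = N%:R^-1 by rewrite ger0_norm// invr_ge0 ltW.
elim: l x => [//|u l IH] x /= /andP[u1 l1]; rewrite inE.
have [-> _ hc|_ /= vl hc] := eqVneq v u.
  under eq_bigr do rewrite avgB avg_shift -addrA -mulrSr.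
  rewrite -(big_mkord xpredT (fun k => avg l h (x + u *+ k.+1) - avg l h (x + u *+ k))).
  rewrite telescope_sumr// normrM normNV.
  rewrite ler_pdivrMl// [leRHS]mulrC divfK ?gt_eqF// mulrDl mul1r.
  apply: le_trans (ler_normB _ _) _; apply: lerD; apply: avg_norm_le => // y yx.
    exact/hc/(box_cons u1 (leqnn N) yx).
  exact/hc/(box_cons u1 (leq0n N) yx).
rewrite normrM normNV ler_pdivrMl//.
apply: le_trans (ler_norm_sum _ _ _) _; rewrite [leRHS]mulr_natl.
rewrite -[N in _ *+ N]card_ord -sumr_const; apply: ler_sum => k _.
apply: IH => // y yx; exact/hc/(box_cons u1 (ltnW (ltn_ord k)) yx).
Qed.

End Averages.

(** Pushes an ultrafilter on indices to the real line, where compactness of segments yields a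
    limit. *)
Lemma fmap_ultra (S T : Type) (f : S -> T) (F : set_system S) :
  UltraFilter F -> UltraFilter (f @ F).
Proof.
move=> FU; split; first exact: fmap_proper_filter.
move=> G GF FG; apply/seteqP; split => // A GA.
have [//|FcA] := in_ultra_setVsetC (f @^-1` A) FU.
have GcA : G (~` A) by exact: FG.
by case: (filter_not_empty G); rewrite -(setICr A); exact: filterI.
Qed.

Section Ultralimit.
Context {R : realType} (U : set_system nat) (FU : UltraFilter U).
Hypothesis U_oo : \oo `<=` U.
Implicit Types u v : nat -> R.

Definition bounded_seq u := exists c : R, forall n, `|u n| <= c.

(** A generalized limit, linear and monotone on all bounded sequences: no convergence of the
    averages has to be proved. *)
Definition ulim u : R := lim (u @ U).

Lemma ulim_cvg u : bounded_seq u -> u @ U --> ulim u.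
Proof.
move=> [c uc]; have := @segment_compact R (- c) c; rewrite compact_ultra.
move=> /(_ (u @ U) (fmap_ultra u FU))[].
- by apply: (@filterE _ U) => n /=; rewrite in_itv /= -ler_norml.
- by move=> r [_ /= ur]; apply/cvg_ex; exists r.
Qed.

Lemma ulimD u v : bounded_seq u -> bounded_seq v ->
  ulim (fun n => u n + v n) = ulim u + ulim v.
Proof. by move=> /ulim_cvg cu /ulim_cvg cv; apply: cvg_lim => //; exact: cvgD. Qed.

Lemma ulimZ (c : R) u : bounded_seq u -> ulim (fun n => c * u n) = c * ulim u.
Proof. by move=> /ulim_cvg cu; apply: cvg_lim => //; exact: cvgMr. Qed.

Lemma ulim_le u c : bounded_seq u -> (forall n, u n <= c) -> ulim u <= c.
Proof.
move=> /ulim_cvg cu uc; rewrite -(cvg_lim _ cu)//.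
by apply: limr_le; [apply/cvg_ex; eexists; exact: cu|exact: (@filterE _ U)].
Qed.

(** Ordinary convergence to 0 passes to [U] because [U] refines [\oo]. *)
Lemma ulim_eq0 u c : (forall n, `|u n| <= c / n.+1%:R) -> ulim u = 0.
Proof.
move=> uc; apply: cvg_lim => //; apply: cvg_trans (cvg_app u U_oo) _.
apply/cvgrPdist_le => e e0; near=> n; rewrite sub0r normrN.
apply: le_trans (uc n) _; rewrite ler_pdivrMr// mulrC -ler_pdivrMr//.
apply: (@le_trans _ _ n%:R); last by rewrite ler_nat.
by apply/ltW; near: n; exact: nbhs_infty_gtr.
Unshelve. all: by end_near. Qed.

End Ultralimit.

(** * Linear selectors *)

Section Selector.
Context {R : realType} {d : nat}.
Notation V := 'rV[R]_d.
Implicit Types (x y z w : V) (A B : set V) (g h : V -> R).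

(** The laws other than membership are asked of bounded nonempty sets, so that they apply to sums
    and dilations directly. *)
Definition selector (c : R) (s : set V -> V) : Prop :=
  [/\ 0 <= c,
      forall A, Conv A -> A (s A),
      forall A B, bounded_nonempty A -> bounded_nonempty B ->
        s (minkowski_sum A B) = s A + s B,
      forall (r : R) A, 0 <= r -> bounded_nonempty A ->
        s [set r *: a | a in A] = r *: s A &
      forall A B, bounded_nonempty A -> bounded_nonempty B ->
        `|s A - s B| <= c * hausdorff_dist A B].

Context (U : set_system nat) (FU : UltraFilter U) (U_oo : \oo `<=` U) (a : V).

Let E : seq V := [seq delta_mx 0 i | i <- enum 'I_d].

Let E1 : all (fun v => `|v| <= 1) E.
Proof.
apply/allP => _ /mapP[i _ ->]; apply: norm_le_coord => // j.
by rewrite mxE; case: (_ && _); rewrite ?normr1 ?normr0.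
Qed.

Let sizeE : size E = d. Proof. by rewrite size_map size_enum_ord. Qed.

Let EP i : delta_mx 0 i \in E. Proof. by rewrite map_f ?mem_enum. Qed.

Let lavg h : R := ulim U (fun n => avg n.+1 E h (n.+1%:R *: a)).

Let bounded_avg h (c : R) : (forall y, `|h y| <= c) ->
  bounded_seq (fun n => avg n.+1 E h (n.+1%:R *: a)).
Proof. by move=> hc; exists c => n; apply: avg_norm_le => // y _; exact: hc. Qed.

(* The averages are taken over boxes that go to infinity in the direction [a]. *)
Let delta A w : R := lavg (fun y => suppf A (y + w) - suppf A y).

Definition sel A : V := \row_i delta A (delta_mx 0 i).

(** By subadditivity the difference lies between [- suppf A (- w)] and [suppf A w], whatever [y]
    is. *)
Let diff_bound A w : bounded_nonempty A ->
  exists c : R, forall y, `|suppf A (y + w) - suppf A y| <= c.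
Proof.
move=> bA; have [c c0 Ac] := support_bound bA.
exists (c * `|w|) => y; have := Ac w; have := Ac (- w); rewrite normrN.
have := supportD y w bA; have := supportD (y + w) (- w) bA; rewrite addrK.
rewrite !ler_norml; lra.
Qed.

Let bounded_delta A w : bounded_nonempty A -> bounded_seq
  (fun n => avg n.+1 E (fun y => suppf A (y + w) - suppf A y) (n.+1%:R *: a)).
Proof. by move=> /(diff_bound w)[c Ac]; exact: bounded_avg Ac. Qed.

Let delta_le A w : bounded_nonempty A -> delta A w <= suppf A w.
Proof.
move=> bA; apply: ulim_le => [|n]; first exact: bounded_delta.
by apply: avg_le => // y _; rewrite lerBlDl supportD.
Qed.

(** A shift along a direction of the box changes the average by at most [2 * c / n.+1]. *)
Let lavg_shift h (c : R) i : (forall y, `|h y| <= c) ->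
  lavg (fun y => h (y + delta_mx 0 i)) = lavg h.
Proof.
move=> hc; apply/eqP; rewrite -subr_eq0 -mulN1r /lavg -ulimZ; last exact: bounded_avg hc.
rewrite -ulimD//; first last.
- by have [M hM] := bounded_avg hc; exists M => n; rewrite mulN1r normrN.
- by apply: (@bounded_avg _ c).
apply/eqP; apply: (@ulim_eq0 _ _ _ _ _ (2 * c)) => // n.
by rewrite mulN1r -avgB; exact: avg_diff_le.
Qed.

(** The difference along [w + e_i] is the one along [w], shifted by [e_i], plus the one along [e_i];
    the shift does not alter the limit average. *)
Let deltaD A w i : bounded_nonempty A ->
  delta A (w + delta_mx 0 i) = delta A w + delta A (delta_mx 0 i).
Proof.
move=> bA; have [c Ac] := diff_bound w bA.
rewrite -[delta A w](lavg_shift i Ac) /delta /lavg -ulimD//.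
- congr (ulim _ _); apply/funext => n; rewrite -avgD; apply: eq_avg => y.
  have -> : y + (w + delta_mx 0 i) = y + delta_mx 0 i + w by rewrite addrA addrAC.
  lra.
- by apply: (@bounded_avg _ c).
- exact: bounded_delta.
Qed.

Let deltaMz A w i (k : int) : bounded_nonempty A ->
  delta A (w + k%:~R *: delta_mx 0 i) = delta A w + k%:~R * delta A (delta_mx 0 i).
Proof.
move=> bA; have H n v : delta A (v + n%:R *: delta_mx 0 i) =
    delta A v + n%:R * delta A (delta_mx 0 i).
  elim: n => [|n IH]; first by rewrite scale0r mul0r !addr0.
  by rewrite -natr1 scalerDl scale1r addrA deltaD// IH mulrDl mul1r addrA.
case: k => n; first exact: H.
rewrite NegzE mulrNz scaleNr mulNr.
(* For a negative multiple, the natural case is applied from the subtracted point back to [w]. *)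
by apply/eqP; rewrite -subr_eq opprK -H subrK.
Qed.

(** Built up one coordinate at a time. Only integer vectors are reached this way, which is what
    [le_support_integer] asks for. *)
Let delta_integer A (z : 'rV[int]_d) : bounded_nonempty A ->
  delta A (map_mx intr z) = dot (map_mx intr z) (sel A).
Proof.
move=> bA; rewrite {1}[map_mx intr z]row_sum_delta /dot.
elim/big_rec2: _ => [|i u v _ <-]; last first.
  by rewrite addrC mxE deltaMz// addrC !mxE.
apply: (@ulim_eq0 _ _ _ _ _ 0) => // n; rewrite mul0r.
by apply: avg_norm_le => // y _; rewrite addr0 subrr normr0.
Qed.

Let sel_mem A : Conv A -> A (sel A).
Proof.
move=> cA; have bA := Conv_bounded_nonempty cA; have [A0 kA _] := cA.
apply: mem_le_support => //; first exact: Conv_midpoint_closed.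
apply: le_support_integer => // z.
by rewrite -delta_integer// delta_le.
Qed.

Let sel_minkowski A B : bounded_nonempty A -> bounded_nonempty B ->
  sel (minkowski_sum A B) = sel A + sel B.
Proof.
move=> bA bB; apply/rowP => i; rewrite !mxE /delta /lavg -ulimD//; try exact: bounded_delta.
congr (ulim _ _); apply/funext => n; rewrite -avgD; apply: eq_avg => y.
by rewrite !support_minkowski//; lra.
Qed.

Let sel_scale (r : R) A : 0 <= r -> bounded_nonempty A ->
  sel [set r *: a | a in A] = r *: sel A.
Proof.
move=> r0 bA; apply/rowP => i; rewrite !mxE /delta /lavg -ulimZ//; last exact: bounded_delta.
congr (ulim _ _); apply/funext => n; rewrite -avgZ; apply: eq_avg => y.
by rewrite !support_scale//; lra.
Qed.

Let sel_lipschitz A B : bounded_nonempty A -> bounded_nonempty B ->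
  `|sel A - sel B| <= 2 * (d%:R * (`|a| + d%:R)) * hausdorff_dist A B.
Proof.
move=> bA bB; have H0 := hausdorff_ge0 bA bB.
apply: norm_le_coord => [|i]; first by rewrite !mulr_ge0// addr_ge0.
pose g y := suppf A y - suppf B y.
have uE : (fun n => avg n.+1 E (fun y => g (y + delta_mx 0 i) - g y) (n.+1%:R *: a)) =
    (fun n => avg n.+1 E (fun y => suppf A (y + delta_mx 0 i) - suppf A y) (n.+1%:R *: a) +
      -1 * avg n.+1 E (fun y => suppf B (y + delta_mx 0 i) - suppf B y) (n.+1%:R *: a)).
  apply/funext => n; rewrite -avgZ -avgD; apply: eq_avg => y; rewrite /g; lra.
set C := _ * hausdorff_dist A B.
have gC n : `|avg n.+1 E (fun y => g (y + delta_mx 0 i) - g y) (n.+1%:R *: a)| <= C.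
  (* On the box [|y| <= n.+1 * (|a| + d)], so [g] is of order [n.+1] there; the factor [2 / n.+1] of
     [avg_diff_le] cancels this and leaves [C]. *)
  have -> : C = 2 * (n.+1%:R * (d%:R * hausdorff_dist A B * (`|a| + d%:R))) / n.+1%:R.
    by rewrite mulrCA [_ * (_ * _)]mulrC mulrK ?unitfE// /C; lra.
  apply: avg_diff_le => // y; rewrite sizeE => ya.
  apply: le_trans (support_lipschitz y bA bB) _.
  rewrite mulrCA ler_wpM2l//; first by rewrite mulr_ge0.
  rewrite -[y](subrK (n.+1%:R *: a)) addrC; apply: le_trans (ler_normD _ _) _.
  by rewrite mulrDr lerD// normrZ ger0_norm.
have bB' : bounded_seq (fun n => -1 * avg n.+1 E
    (fun y => suppf B (y + delta_mx 0 i) - suppf B y) (n.+1%:R *: a)).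
  by have [M hM] := bounded_delta (delta_mx 0 i) bB; exists M => n; rewrite mulN1r normrN.
have bAB : bounded_seq (fun n =>
    avg n.+1 E (fun y => g (y + delta_mx 0 i) - g y) (n.+1%:R *: a)) by exists C.
have -> : (sel A - sel B) 0 i = ulim U (fun n =>
    avg n.+1 E (fun y => g (y + delta_mx 0 i) - g y) (n.+1%:R *: a)).
  rewrite uE ulimD//; last exact: bounded_delta.
  by rewrite ulimZ; [rewrite !mxE mulN1r|exact: bounded_delta].
rewrite ler_norml lerNl -mulN1r -ulimZ//; apply/andP; split; apply: ulim_le => //.
- by have [M hM] := bAB; exists M => n; rewrite mulN1r normrN.
- by move=> n; have := gC n; rewrite ler_norml mulN1r => /andP[]; lra.
- by move=> n; have := gC n; rewrite ler_norml => /andP[].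
Qed.

Lemma sel_selector : selector (2 * (d%:R * (`|a| + d%:R))) sel.
Proof. by split=> //; rewrite !mulr_ge0// addr_ge0. Qed.

(* The box of side [n] is based at [y0 = n m z]. Being convex, the support
   function grows from [y] to [y + z] at least as fast as on average between
   [k = y - y0] and [y], where [k] is [O(n)] and [y - k] is [n m] times [z]. *)
Lemma sel_suppf A (z : 'rV[int]_d) (m : nat) (c : R) : (0 < m)%N -> 0 <= c ->
  a = m%:R *: map_mx intr z -> bounded_nonempty A ->
  (forall y, `|suppf A y| <= c * `|y|) ->
  suppf A (map_mx intr z) <= dot (map_mx intr z) (sel A) + 2 * c * d%:R / m%:R.
Proof.
move=> m0 c0 az bA Ac; rewrite -delta_integer//.
set w := map_mx _ _ in az *.
have mR : 0 < m%:R :> R by rewrite ltr0n.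
(* [ulim_le] gives upper bounds, so the lower bound on [delta] is proved for its opposite. *)
suff : -1 * delta A w <= - suppf A w + 2 * c * d%:R / m%:R by lra.
rewrite -ulimZ//; last exact: bounded_delta.
apply: ulim_le => [|n].
  by have [M hM] := bounded_delta w bA; exists M => n; rewrite mulN1r normrN.
rewrite -avgZ; apply: avg_le => // y; rewrite sizeE => ya.
set J := n.+1%:R * m%:R : R; set k := y - n.+1%:R *: a in ya.
have nR : 0 < n.+1%:R :> R by rewrite ltr0n.
have J0 : 0 < J by rewrite mulr_gt0.
have yE : y = J *: w + k by rewrite /k az scalerA -/J subrKC.
have ck : c * `|k| <= n.+1%:R * c * d%:R.
  by rewrite (mulrC _ c) -mulrA ler_wpM2l.
have h1 := Ac k; have h2 := Ac (- k); rewrite normrN in h2.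
(* With [h4], this gives [J (suppf A (y + w) - suppf A y) >= J suppf A w - suppf A k - suppf A (-
   k)]. The last two terms are at most [n.+1 * c * d] each, and division by [J = n.+1 * m] leaves
   the error [2 * c * d / m]. *)
have h3 : J * suppf A w <= suppf A y + suppf A (- k).
  by rewrite -(supportZ _ bA (ltW J0)) -[J *: w](addrK k) -yE supportD.
have h4 : (J + 1) * suppf A y <= J * suppf A (y + w) + suppf A k.
  have J1 : 0 <= J + 1 by lra.
  rewrite -(supportZ _ bA J1) -(supportZ _ bA (ltW J0)).
  rewrite (_ : (J + 1) *: y = J *: (y + w) + k) ?supportD//.
  by rewrite scalerDl scale1r scalerDr -addrA -yE.
have h5 : J * (2 * c * d%:R / m%:R) = 2 * (n.+1%:R * c * d%:R).
  by rewrite /J mulrA -mulrA mulrACA [m%:R * _]mulrC; field; rewrite gt_eqF.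
rewrite -(ler_pM2l J0); move: h1 h2; rewrite !ler_norml => /andP[_ h1] /andP[_ h2].
rewrite [leRHS]mulrDr h5; lra.
Qed.

End Selector.

(** * Countably many selectors, dense in every convex body *)

Section Selectors.
Context {R : realType} {d : nat}.
Notation V := 'rV[R]_d.
Implicit Types (A : set V) (s : set V -> V).

Lemma selector_midpoint s1 s2 (c1 c2 : R) : selector c1 s1 -> selector c2 s2 ->
  selector (c1 + c2) (fun A => 2^-1 *: (s1 A + s2 A)).
Proof.
move=> [c10 m1 a1 h1 l1] [c20 m2 a2 h2 l2]; split=> [||A B bA bB|r A r0 bA|A B bA bB].
- exact: addr_ge0.
- by move=> A cA; apply: Conv_midpoint_closed; [|exact: m1|exact: m2].
- by rewrite a1// a2// addrACA scalerDr.
- by rewrite h1// h2// -scalerDr scalerA mulrC -scalerA.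
- rewrite -scalerBr opprD addrACA normrZ.
  have l : `|s1 A - s1 B + (s2 A - s2 B)| <= (c1 + c2) * hausdorff_dist A B.
    by apply: le_trans (ler_normD _ _) _; rewrite mulrDl lerD// ?l1 ?l2.
  apply: le_trans l; rewrite ler_piMl// ger0_norm; lra.
Qed.

(** Formal iterated midpoints. The encoding into generic trees makes them countable, hence indexable
    by natural numbers. *)
Inductive tree (T : Type) := leaf of T | node of tree T & tree T.

Fixpoint gen_of_tree (T : Type) (t : tree T) : GenTree.tree T :=
  match t with
  | leaf a => GenTree.Leaf a
  | node l r => GenTree.Node 0 [:: gen_of_tree l; gen_of_tree r]
  end.

Fixpoint tree_of_gen (T : Type) (g : GenTree.tree T) : option (tree T) :=
  match g with
  | GenTree.Leaf a => Some (leaf a)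
  | GenTree.Node _ [:: l; r] =>
    if (tree_of_gen l, tree_of_gen r) is (Some l', Some r') then Some (node l' r')
    else None
  | _ => None
  end.

Lemma gen_of_treeK (T : Type) : pcancel (@gen_of_tree T) (@tree_of_gen T).
Proof. by elim=> //= l -> r ->. Qed.

HB.instance Definition _ (T : countType) :=
  Countable.copy (tree T) (pcan_type (@gen_of_treeK T)).

Lemma closure_normP A (a : V) :
  closure A a <-> forall e : R, 0 < e -> exists2 x, A x & `|a - x| < e.
Proof.
split=> [cA e e0|H B /nbhs_ballP[e e0 eB]].
  have [x [Ax]] := cA _ (nbhsx_ballx a e e0).
  by rewrite -ball_normE; exists x.
have [x Ax ax] := H e e0; exists x; split=> //.
by apply: eB; rewrite -ball_normE.
Qed.

Lemma closure_midpoint_closed A : midpoint_closed A -> midpoint_closed (closure A).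
Proof.
move=> mA a b /closure_normP ca /closure_normP cb; apply/closure_normP => e e0.
have [x Ax ax] := ca e e0; have [y Ay bY] := cb e e0.
exists (2^-1 *: (x + y)); first exact: mA.
rewrite -scalerBr opprD addrACA normrZ ger0_norm ?invr_ge0//.
by rewrite ltr_pdivrMl// mulr2n mulrDl mul1r (le_lt_trans (ler_normD _ _))// ltrD.
Qed.

(* Leaves are indexed by the integer vector [z] and the scale [m] of
   [sel_suppf], with [a = (m + 1) z]; nodes are midpoints. *)
Lemma exists_dense_selectors : exists s : nat -> set V -> V,
  (forall n, exists c, selector c (s n)) /\
  forall A, Conv A -> A = closure (range (fun n => s n A)).
Proof.
have [U [FU U_oo]] := ultraFilterLemma (@eventually_filter).
pose scaled (zm : 'rV[int]_d * nat) : V := zm.2.+1%:R *: map_mx intr zm.1.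
pose fix tsel (t : tree ('rV[int]_d * nat)%type) (A : set V) {struct t} : V :=
  match t with
  | leaf zm => sel U (scaled zm) A
  | node l r => 2^-1 *: (tsel l A + tsel r A)
  end.
have tselP t : exists c, selector c (tsel t).
  elim: t => [zm|l [c1 s1] r [c2 s2]].
    by exists (2 * (d%:R * (`|scaled zm| + d%:R))); exact: sel_selector.
  by exists (c1 + c2); exact: selector_midpoint.
pose t0 : tree ('rV[int]_d * nat)%type := leaf (0, 0%N).
(* Integers that encode no tree are sent to the default [t0]. *)
exists (fun n => tsel (odflt t0 (unpickle n))); split=> // A cA.
have bA := Conv_bounded_nonempty cA; have [A0 kA _] := cA.
set S := (X in closure X); have St t : S (tsel t A).
  by exists (pickle t) => //=; rewrite pickleK.
have SA : S `<=` A.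
  by move=> _ [n _ <-]; have [c [_ mem _ _ _]] := tselP (odflt t0 (unpickle n)); exact: mem.
have clA : closed A by apply: compact_closed => //; exact: norm_hausdorff.
have cSA : closure S `<=` A by rewrite (closure_id A).1//; exact: closure_subset.
apply/seteqP; split=> // x Ax.
have bS : bounded_nonempty (closure S).
  split; first by exists (tsel t0 A); exact: subset_closure.
  by have [_ [M M0 AM]] := bA; exists M => // a /cSA /AM.
(* Support functions decide membership: at integer vectors, that of [closure S] comes within any [e]
   of that of [A]. *)
apply: mem_le_support.
- by apply: subclosed_compact kA _ => //; exact: closed_closure.
- by case: bS.
- apply: closure_midpoint_closed => _ _ [n1 _ <-] [n2 _ <-].
  exact: (St (node _ _)).
apply: le_support_integer => // z.
have [c c0 Ac] := support_bound bA.
apply/ler_addgt0Pr => e e0.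
(* Large enough for the error [2 * c * d / m.+1] of [sel_suppf] to be at most [e]. *)
pose m := Num.bound (2 * c * d%:R / e).
apply: le_trans (support_ge (map_mx intr z) bA Ax) _.
have := @sel_suppf R d U FU U_oo (scaled (z, m)) A z m.+1 c.
move=> /(_ isT c0 erefl bA Ac) h; apply: (le_trans h); apply: lerD.
  by apply: support_ge => //; apply: subset_closure; exact: (St (leaf (z, m))).
rewrite ler_pdivrMr// [leRHS]mulrC -ler_pdivrMr//.
apply: le_trans (ltW (archi_boundP _)) _; first by rewrite divr_ge0 ?(ltW e0)// !mulr_ge0.
by rewrite ler_nat leqnSn.
Qed.
End Selectors.

(** * Riesz variation and difference quotients *)

Section Powers.
Context {R : realType}.

(** At a positive limit the power is differentiable, hence continuous; at 0 monotonicity is used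
    instead, with threshold [e] to the power [1 / p]. *)
Lemma cvg_powR (p : R) (u : nat -> R) (a : R) : 0 < p -> (forall n, 0 <= u n) ->
  u @ \oo --> a -> (fun n => u n `^ p) @ \oo --> a `^ p.
Proof.
move=> p0 u0 ua.
have : 0 <= a.
  rewrite -(cvg_lim _ ua)//; apply: limr_ge; last exact: nearW.
  by apply/cvg_ex; exists a.
rewrite le_eqVlt => /predU1P[a0|a0]; last first.
  apply: (@cvg_comp _ _ _ u (fun x => x `^ p) _ (nbhs a) _ ua).
  have : differentiable (fun x : R => x `^ p) a.
    apply/derivable1_diffP/derivable_powR.
    by rewrite in_itv /= a0.
  exact: differentiable_continuous.
move: ua; rewrite -a0 powR0 ?gt_eqF// => ua.
apply/cvgrPdist_lt => e e0; near=> n.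
rewrite sub0r normrN ger0_norm ?powR_ge0//.
have -> : e = (e `^ p^-1) `^ p by rewrite -powRrM mulVf ?gt_eqF// powRr1// ltW.
rewrite gt0_ltr_powR// ?nnegrE ?powR_ge0//.
apply: le_lt_trans (ler_norm _) _; rewrite -[u n]subr0 -normrN opprB.
near: n; move/cvgrPdist_lt : ua; apply; exact: powR_gt0.
Unshelve. all: by end_near. Qed.

End Powers.

Section Riesz_variation.
Context {R : realType}.

Lemma riesz_variation_ltyP (E : Type) (rho : E -> E -> R) (p a b : R) (f : R -> E) :
  (riesz_variation rho p a b f < +oo)%E <->
  exists M : R, forall s, itv_partition a b s -> riesz_sum rho p a b f s <= M.
Proof.
split=> [|[M fM]].
  have ub s : itv_partition a b s ->
      ((riesz_sum rho p a b f s)%:E <= riesz_variation rho p a b f)%E.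
    by move=> abs; apply: ereal_sup_ubound; exists s.
  case: (riesz_variation _ _ _ _ _) ub => [M ub _|//|ub _].
    by exists M => s /ub; rewrite lee_fin.
  by exists 0 => s /ub.
apply: (@le_lt_trans _ _ M%:E); last exact: ltry.
by apply: ge_ereal_sup => _ [s abs <-]; rewrite lee_fin fM.
Qed.

Lemma riesz_sum_le (E1 E2 : Type) (rho1 : E1 -> E1 -> R) (rho2 : E2 -> E2 -> R)
    (p a b c : R) (f1 : R -> E1) (f2 : R -> E2) (s : seq R) :
  0 <= p -> 0 <= c ->
  (forall x y, a <= x <= b -> a <= y <= b ->
    [/\ 0 <= rho1 (f1 x) (f1 y), 0 <= rho2 (f2 x) (f2 y) &
      rho1 (f1 x) (f1 y) <= c * rho2 (f2 x) (f2 y)]) ->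
  itv_partition a b s ->
  riesz_sum rho1 p a b f1 s <= c `^ p * riesz_sum rho2 p a b f2 s.
Proof.
move=> p0 c0 H abs; rewrite /riesz_sum !big_mkord mulr_sumr.
apply: ler_sum => i _; rewrite mulrA ler_wpM2r ?invr_ge0 ?powR_ge0//.
have ab k : (k <= size s)%N -> a <= nth b (a :: s) k <= b.
  by move=> ks; rewrite (itv_partition_nth_ge _ abs)// (itv_partition_nth_le _ abs).
have [r1 r2 r12] := H _ _ (ab i (ltnW (ltn_ord i))) (ab i.+1 (ltn_ord i)).
by rewrite -powRM// ge0_ler_powR// nnegrE ?mulr_ge0.
Qed.

Lemma uniform_itv_partition (T : R) (n : nat) : 0 < T ->
  itv_partition 0 T (mkseq (fun k => k.+1%:R * (T / n.+1%:R)) n.+1).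
Proof.
move=> T0; have D0 : 0 < T / n.+1%:R by rewrite divr_gt0.
split; last by rewrite -nth_last size_mkseq nth_mkseq// mulrC divfK.
apply/(pathP 0) => i; rewrite size_mkseq => ni; rewrite nth_mkseq//.
case: i ni => [|i] ni; first by rewrite mulr_gt0.
by rewrite -nth_behead nth_mkseq 1?ltnW// ltr_pM2r// ltr_nat.
Qed.

End Riesz_variation.

Section Euclidean_norm.
Context {R : realType} {d : nat}.
Implicit Types x : 'rV[R]_d.

Lemma euclidean_normZ (c : R) x : euclidean_norm (c *: x) = `|c| * euclidean_norm x.
Proof.
rewrite /euclidean_norm -sqrtr_sqr -sqrtrM ?sqr_ge0// mulr_sumr; congr Num.sqrt.
by apply: eq_bigr => i _; rewrite mxE exprMn.
Qed.

Lemma euclidean_normN x : euclidean_norm (- x) = euclidean_norm x.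
Proof. by rewrite -scaleN1r euclidean_normZ normrN normr1 mul1r. Qed.

End Euclidean_norm.

(** * Measurability and p-integrability of a derivative *)

Section Difference_quotients.
Context {R : realType} {d : nat}.
Notation V := 'rV[R]_d.
Context (T : R) (T0 : 0 < T) (f phi : R -> V).
(** Differentiability as a first-order expansion relative to [[0, T]], hence one-sided at 0; [T]
    lies outside the half-open cells used below. *)
Hypothesis f_phi : forall t, 0 <= t < T -> forall e : R, 0 < e ->
  exists2 r, 0 < r & forall x, 0 <= x <= T -> `|x - t| < r ->
    `|f x - f t - (x - t) *: phi t| <= e * `|x - t|.

Let mesh (n : nat) : R := T / n.+1%:R.
Let mesh_gt0 n : 0 < mesh n. Proof. by rewrite divr_gt0. Qed.
Let mesh_cell n k : k.+1%:R * mesh n - k%:R * mesh n = mesh n.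
Proof. by rewrite -mulrBl -natrB// subSnn mul1r. Qed.

Let slope n k : V := (mesh n)^-1 *: (f (k.+1%:R * mesh n) - f (k%:R * mesh n)).
Let cell n k : set R := `[k%:R * mesh n, k.+1%:R * mesh n[.
(** Taken with [g] a coordinate for measurability, and with [g] the [p]-th power of the Euclidean
    norm for Fatou's lemma. *)
Let step (g : V -> R) n t : R := \sum_(k < n.+1) g (slope n k) * \1_(cell n k) t.
Let measurable_cell n k : measurable (cell n k). Proof. exact: measurable_itv. Qed.
Let mindic D n k : measurable_fun D (\1_(cell n k) : R -> R).
Proof. by apply: measurable_indic; exact: measurable_cell. Qed.
Let index n t := Num.trunc (t / mesh n).

Let indexP n t : 0 <= t -> (index n t)%:R * mesh n <= t < (index n t).+1%:R * mesh n.
Proof.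
move=> t0; rewrite -ler_pdivlMr// -ltr_pdivrMr//.
by apply: truncn_itv; rewrite divr_ge0// ltW.
Qed.

Let index_lt n t : 0 <= t < T -> (index n t < n.+1)%N.
Proof.
move=> /andP[t0 tT]; rewrite -(ltr_nat R).
have /andP[h _] := indexP n t0; rewrite -(ltr_pM2r (mesh_gt0 n)).
by apply: le_lt_trans h _; rewrite /mesh mulrC divfK.
Qed.

Let stepE g n t : 0 <= t < T -> step g n t = g (slope n (index n t)).
Proof.
move=> tT; have [t0 _] := andP tT; have /andP[it ti] := indexP n t0.
rewrite /step (bigD1 (Ordinal (index_lt n tT)))//= big1 => [|k kn].
  by rewrite indicE mem_set ?mulr1 ?addr0// /cell /= in_itv /= it ti.
rewrite indicE memNset ?mulr0// /cell /= in_itv /= => /andP[kt tk].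
move/negP: kn; apply; apply/eqP/val_inj => /=; apply/eqP.
rewrite eqn_leq; apply/andP; split; rewrite -ltnS -(ltr_nat R) -(ltr_pM2r (mesh_gt0 n)).
  exact: le_lt_trans kt ti.
exact: le_lt_trans it tk.
Qed.

(** The cell from [x] to [y] straddles [t]: subtracting the expansions at [x] and [y], the errors
    add up to [e (t - x) + e (y - t) = e (y - x)]. *)
Let slope_cvg t : 0 <= t < T -> forall e : R, 0 < e ->
  \forall n \near \oo, `|phi t - slope n (index n t)| <= e.
Proof.
move=> tT e e0; have [r r0 fr] := f_phi tT e0; have [t0 tT'] := andP tT.
near=> n; have /andP[it ti] := indexP n t0.
have nr : mesh n < r.
  rewrite ltr_pdivrMr// mulrC -ltr_pdivrMr// (@lt_trans _ _ n%:R)//.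
    by near: n; exact: nbhs_infty_gtr.
  by rewrite ltr_nat.
set x := _ * mesh n in it; set y := _ * mesh n in ti.
have xy : y - x = mesh n by exact: mesh_cell.
have m0 := mesh_gt0 n.
have x0 : 0 <= x by rewrite mulr_ge0// ltW.
have yT : y <= T.
  apply: (@le_trans _ _ (n.+1%:R * mesh n)); last by rewrite /mesh mulrC divfK.
  by rewrite ler_pM2r// ler_nat index_lt.
have hx : `|f x - f t - (x - t) *: phi t| <= e * (t - x).
  have xt : `|x - t| = t - x by rewrite distrC ger0_norm// subr_ge0.
  have := fr x; rewrite xt; apply; last lra.
  by rewrite x0 (le_trans it)// ltW.
have hy : `|f y - f t - (y - t) *: phi t| <= e * (y - t).
  have yt : `|y - t| = y - t by rewrite ger0_norm// subr_ge0 ltW.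
  have := fr y; rewrite yt; apply; last lra.
  by rewrite yT andbT (le_trans t0)// ltW.
rewrite distrC -(ler_pM2l m0) -{1}(ger0_norm (ltW m0)) -normrZ.
rewrite scalerBr scalerA mulfV ?gt_eqF// scale1r -/x -/y -xy.
rewrite (_ : _ - _ = (f y - f t - (y - t) *: phi t) - (f x - f t - (x - t) *: phi t)).
  apply: le_trans (ler_normB _ _) _; lra.
by apply/rowP => i; rewrite !mxE; ring.
Unshelve. all: by end_near. Qed.

Let measurable_step g n : measurable_fun setT (step g n).
Proof.
by apply: measurable_sum => k; apply: measurable_funM.
Qed.

Lemma measurable_derivative i : measurable_fun `[0, T] (fun t => phi t 0 i).
Proof.
(* The cells leave out [T], a single point that does not affect measurability. *)
apply/measurable_fun_itv_bndo_bndcP.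
apply: (@measurable_fun_cvg _ _ R _ (fun n => step (fun w => w 0 i) n)) => [n|t].
  exact: measurable_funTS.
rewrite /= in_itv /= => tT; apply/cvgrPdist_le => e e0.
near=> n; rewrite stepE//.
apply: (@le_trans _ _ `|phi t - slope n (index n t)|).
  by have := coord_le_norm (phi t - slope n (index n t)) i; rewrite !mxE.
by near: n; exact: slope_cvg.
Unshelve. all: by end_near. Qed.

Lemma Lp_derivative (p : R) : 1 <= p -> BVp T p f -> Lp T p phi.
Proof.
move=> p1 /riesz_variation_ltyP[M fM]; split; first exact: measurable_derivative.
have p0 : 0 < p by exact: lt_le_trans p1.
pose g (w : V) := euclidean_norm w `^ p.
have gslope t : 0 <= t < T -> (fun n => step g n t) @ \oo --> g (phi t).
  move=> tT; under eq_fun do rewrite stepE//.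
  apply: cvg_powR => // [n|]; first exact: sqrtr_ge0.
  apply: (@cvg_comp _ _ _ (fun n => \sum_i slope n (index n t) 0 i ^+ 2) Num.sqrt _
    (nbhs (\sum_i phi t 0 i ^+ 2))); last exact: sqrt_continuous.
  apply: (@cvg_big _ _ _ 0 xpredT add_continuous) => i _.
  apply: (@cvg_comp _ _ _ (fun n => slope n (index n t) 0 i) (fun x : R => x ^+ 2) _
    (nbhs (phi t 0 i))); last exact: exprn_continuous.
  apply/cvgrPdist_le => e e0; near=> n.
  apply: (@le_trans _ _ `|phi t - slope n (index n t)|).
    by have := coord_le_norm (phi t - slope n (index n t)) i; rewrite !mxE.
  by near: n; exact: slope_cvg.
have g0 w : 0 <= g w by exact: powR_ge0.
have step0 n t : 0 <= step g n t by apply: sumr_ge0 => k _; rewrite mulr_ge0.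
have mstep n : measurable_fun `[0, T[ (EFin \o step g n).
  by apply/measurable_EFinP; exact: measurable_funTS.
have mphi : measurable_fun `[0, T[ (fun t => (g (phi t))%:E).
  apply/measurable_EFinP.
  apply: (@measurable_fun_cvg _ _ R _ (fun n => step g n)) => [n|t /=].
    exact: measurable_funTS.
  by rewrite in_itv /= => /gslope.
have int_step n : (\int[lebesgue_measure]_(t in `[0%R, T[) (step g n t)%:E <= M%:E)%E.
  (* This is the Riesz sum of the uniform partition: each term is an increment to the power [p] over
     [mesh ^ (p - 1)], that is, the slope to the power [p] times [mesh]. *)
  apply: (@le_trans _ _ (\sum_(k < n.+1) g (slope n k) * mesh n)%:E).
    under eq_integral do rewrite /step -sumEFin.
    rewrite ge0_integral_sum//; first last.
    - by move=> k t _; rewrite lee_fin mulr_ge0.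
    - move=> k; apply/measurable_EFinP/measurable_funM => //.
      exact: mindic.
    rewrite -sumEFin; apply: lee_sum => k _; under eq_integral do rewrite EFinM.
    rewrite ge0_integralZl_EFin//; last by apply/measurable_EFinP; exact: mindic.
    rewrite [leRHS]EFinM; apply: lee_wpmul2l; first by rewrite lee_fin.
    rewrite integral_indic//; last exact: measurable_cell.
    apply: (@le_trans _ _ (lebesgue_measure (cell n k))).
      apply: le_measure; rewrite ?inE; [|exact: measurable_cell|exact: subIsetl].
      by apply: measurableI => //; exact: measurable_cell.
    rewrite /cell lebesgue_measure_itv /= lte_fin.
    by case: ifPn => _; [rewrite -EFinB mesh_cell|rewrite lee_fin ltW].
  rewrite lee_fin; apply: le_trans (fM _ (uniform_itv_partition n T0)).
  rewrite /riesz_sum size_mkseq big_mkord; apply: ler_sum => k _.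
  have nthE j : (j < n.+2)%N -> nth T (0 :: mkseq (fun k => k.+1%:R * (T / n.+1%:R)) n.+1) j =
      j%:R * mesh n.
    by case: j => [|j] jn; [rewrite mul0r|rewrite -nth_behead nth_mkseq].
  rewrite (nthE k (ltnW (ltn_ord k))) (nthE k.+1 (ltn_ord k)) mesh_cell.
  have m0 := mesh_gt0 n.
  set w := slope n k.
  have -> : euclidean_dist (f (k%:R * mesh n)) (f (k.+1%:R * mesh n)) =
      mesh n * euclidean_norm w.
    rewrite -[in RHS](ger0_norm (ltW m0)) -euclidean_normZ /w /slope scalerA.
    by rewrite mulfV ?gt_eqF// scale1r -opprB euclidean_normN.
  rewrite powRM ?sqrtr_ge0 ?(ltW m0)// -(mulr_powRB1 (ltW m0) p0).
  have q0 : mesh n `^ (p - 1) != 0 by rewrite gt_eqF// powR_gt0.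
  by rewrite le_eqVlt; apply/orP; left; apply/eqP; rewrite /g; field.
rewrite -(integral_itv_bndo_bndc mphi); apply: (@le_lt_trans _ _ M%:E); last exact: ltry.
(* The integrand is rewritten as a lower limit of step functions, as Fatou's lemma requires. *)
under eq_integral => t.
  rewrite inE /= in_itv /= => tT.
  have <- : limn_einf (fun n => (step g n t)%:E) = (g (phi t))%:E.
    apply: (cvg_limn_einf_sup _).1.
    by apply: cvg_EFin; [exact: nearW|exact: gslope].
  over.
have step0E n t : `[0, T[%classic t -> (0 <= (step g n t)%:E)%E by rewrite lee_fin.
apply: (le_trans (fatou lebesgue_measure (measurable_itv _) mstep step0E)).
rewrite limn_einf_lim; apply: lime_le; first exact: is_cvg_einfs.
by apply: nearW => n; apply: le_trans (int_step n); apply: ereal_inf_lbound; exists n => /=.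
Unshelve. all: by end_near. Qed.

End Difference_quotients.

(** * Selections of a set-valued function *)

Section Selections.
Context {R : realType} {d : nat}.
Notation V := 'rV[R]_d.
Context (T p : R) (T0 : 0 < T) (p1 : 1 <= p) (F : R -> set V).
Hypothesis (hF : BVpConv T p F) (hdiff : hukuhara_differentiable T F).
Context (c : R) (s : set V -> V) (sP : selector c s).

Let f (t : R) := s (F t).
Let DF := hukuhara_derivative T F.

Let ConvF t : 0 <= t <= T -> Conv (F t). Proof. by case: hF => + _; apply. Qed.

Let DFP t : 0 <= t <= T -> is_hukuhara_derivative T F t (DF t).
Proof. by move=> /hdiff; exact: getPex. Qed.

(** Additivity turns [A = B + C] into [s A - s B = s C]; homogeneity and the Lipschitz bound then
    compare [s C] with [h *: s D]. *)
Let selector_diff A B C D (h : R) : 0 < h -> Conv B -> Conv D ->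
  is_hukuhara_diff A B C ->
  `|s A - s B - h *: s D| <= c * hausdorff_dist [set h^-1 *: x | x in C] D * h.
Proof.
move=> h0 /Conv_bounded_nonempty bB /Conv_bounded_nonempty bD.
move=> [/Conv_bounded_nonempty bC ->]; have [_ _ addS scaleS lipS] := sP.
have hV0 : 0 <= h^-1 by rewrite invr_ge0 ltW.
rewrite addS// [s B + _]addrC addrK.
have -> : s C - h *: s D = h *: (s [set h^-1 *: x | x in C] - s D).
  by rewrite scaleS// scalerBr scalerA mulfV ?gt_eqF// scale1r.
rewrite normrZ gtr0_norm// mulrC ler_pM2r// lipS//.
exact: bounded_nonempty_scale.
Qed.

Let quotient_cvg A B D (e : R) : hukuhara_quotient_cvg A B D -> Conv D -> 0 < e ->
  exists2 r, 0 < r & forall h, 0 < h < r -> Conv (B h) ->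
    `|s (A h) - s (B h) - h *: s D| <= e * h.
Proof.
move=> AB cD e0; have [c0 _ _ _ _] := sP.
have c1 : 0 < c + 1 by rewrite ltr_wpDl.
(* The denominator is [c + 1] since [c] may be 0. *)
have [r /= r0 hr] := AB (e / (c + 1)) (divr_gt0 e0 c1).
exists r => // h /andP[h0 hlr] cB.
have [|C hC CD] := hr h _ h0; first by rewrite /= sub0r normrN gtr0_norm.
apply: le_trans (selector_diff h0 cB cD hC) _; rewrite ler_pM2r//.
apply: (le_trans (ler_wpM2l c0 (ltW CD))).
by rewrite mulrCA ger_pMr// ler_pdivrMr// mul1r lerDl.
Qed.

Let f_expansion t : 0 <= t <= T -> forall e : R, 0 < e ->
  exists2 r, 0 < r & forall x, 0 <= x <= T -> `|x - t| < r ->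
    `|f x - f t - (x - t) *: s (DF t)| <= e * `|x - t|.
Proof.
move=> tT e e0; have [cD rD lD] := DFP tT.
have [r1 r10 hr1] : exists2 r, 0 < r & forall x, t < x <= T -> x - t < r ->
    `|f x - f t - (x - t) *: s (DF t)| <= e * (x - t).
  (* At [t = T] no [x] lies to the right and any radius serves; likewise to the left of 0. *)
  have [tlT|Tt] := ltP t T; last by exists 1 => // x; lra.
  have [r r0 hr] := quotient_cvg (rD tlT) cD e0; exists r => // x xt xr.
  have := hr (x - t); rewrite subrKC; apply; [lra|exact: ConvF].
have [r2 r20 hr2] : exists2 r, 0 < r & forall x, 0 <= x < t -> t - x < r ->
    `|f x - f t - (x - t) *: s (DF t)| <= e * (t - x).
  have [tlT|Tt] := ltP 0 t; last by exists 1 => // x; lra.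
  have [r r0 hr] := quotient_cvg (lD tlT) cD e0; exists r => // x xt xr.
  have := hr (t - x); rewrite subKr -normrN => H.
  rewrite (_ : _ - _ = - (s (F t) - s (F x) - (t - x) *: s (DF t))).
    by apply: H; [lra|apply: ConvF; lra].
  by apply/rowP => i; rewrite !mxE; ring.
exists (Num.min r1 r2); first by rewrite lt_min r10.
move=> x xT; rewrite lt_min => /andP[xr1 xr2].
have [xt|tx|->] := ltgtP x t; last by rewrite !subrr scale0r subrr !normr0 mulr0.
  by rewrite distrC gtr0_norm ?subr_gt0// in xr2 *; apply: hr2 => //; lra.
by rewrite gtr0_norm ?subr_gt0// in xr1 *; apply: hr1 => //; lra.
Qed.

Let f_derive t : 0 < t < T -> is_derive t 1 f (s (DF t)).
Proof.
move=> /andP[t0 tT].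
have tT' : 0 <= t <= T by rewrite !ltW.
suff H : h^-1 *: ((f \o shift t) (h *: 1) - f t) @[h --> 0^'] --> s (DF t).
  by split; [apply/cvg_ex; exists (s (DF t))|apply: cvg_lim].
apply/cvgrPdist_le => e e0; have [r r0 hr] := f_expansion tT' e0.
(* Keeps [t + h] in [[0, T]], where the expansion is available. *)
pose r' := Num.min r (Num.min t (T - t)).
have r'0 : 0 < r' by rewrite !lt_min r0 t0 subr_gt0.
exists r' => // h /=; rewrite sub0r normrN !lt_min => /and3P[hr' ht hT] h0.
rewrite [h *: 1]mulr1 distrC -(ler_pM2l (_ : 0 < `|h|)) ?normr_gt0// -normrZ.
rewrite scalerBr scalerA mulfV// scale1r mulrC.
have := hr (h + t); rewrite addrK; apply => //.
by move: ht hT; rewrite !ltr_norml; lra.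
Qed.

Let f_mem t : 0 <= t <= T -> F t (f t).
Proof. by case: sP => _ mem _ _ _ /ConvF; exact: mem. Qed.

Let f_BVp : BVp T p f.
Proof.
case: hF => _ /riesz_variation_ltyP[M FM]; have [c0 _ _ _ lip] := sP.
have p0 : 0 <= p by exact: le_trans p1.
(* [c] is the Lipschitz constant for the sup norm; [d] passes to the Euclidean norm. *)
apply/riesz_variation_ltyP; exists ((d%:R * c) `^ p * M) => u uT.
apply: le_trans (ler_wpM2l (powR_ge0 _ _) (FM _ uT)).
apply: riesz_sum_le => // [|x y /ConvF/Conv_bounded_nonempty bx /ConvF/Conv_bounded_nonempty bY].
  by rewrite mulr_ge0.
split; [exact: sqrtr_ge0|exact: hausdorff_ge0|].
apply: le_trans (euclidean_le_norm _) _.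
by rewrite -mulrA ler_wpM2l// lip.
Qed.

(** [s (DF t)] is the derivative at every interior point and lies in [DF t] on all of [[0, T]], so
    no exceptional null set arises. *)
Lemma selector_IS : IS T p F f.
Proof.
split; first by split; [exact: f_BVp|exact: f_mem].
exists (fun t => s (DF t)); first by apply: aeW => t; exact: f_derive.
split.
  apply: (@Lp_derivative _ _ _ T0 f) => // t /andP[t0 tT] e e0.
  by apply: f_expansion => //; rewrite t0 ltW.
apply: aeW => t tT; have [_ mem _ _ _] := sP.
by apply: mem; have [] := DFP tT.
Qed.

End Selections.

Theorem theorem5 (R : realType) (T : R) (hT : 0 < T) (d : nat) (hd : (1 <= d)%N)
    (p : R) (hp : 1 <= p) (x0 : 'rV[R]_d) (F : R -> set 'rV[R]_d)
    (hF : BVpConv T p F) (hdiff : hukuhara_differentiable T F)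
    (hF0 : F 0 = [set x0]) :
  exists f : nat -> R -> 'rV[R]_d,
    castaing_representation T F f /\ (forall n, IS T p F (f n)).
Proof.
have [s [sP dense]] := @exists_dense_selectors R d.
exists (fun n t => s n (F t)); split; last first.
  by move=> n; have [c snP] := sP n; exact: selector_IS snP.
have ConvF t : 0 <= t <= T -> Conv (F t) by case: hF => + _; apply.
split=> [n t /ConvF Ft|t /ConvF /dense //].
by have [c [_ mem _ _ _]] := sP n; exact: mem.
Qed.
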